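(* Let $r\ge 1$ be an integer and let $P(s)=p\in[0,1]$ be the unknown probability that a single random generation of a model passes a task instance $s$. Suppose independent generations are sampled one after another, each passing with probability $p$, until exactly $r$ of them have passed, and let $K\ge r$ be the total number of generations sampled. Then $\mathrm{PU}=\frac{r}{K}$ is a maximum likelihood estimate for $P(s)$; that is, for every observed value $K=k\ge r$, the value $p=r/k$ maximizes over $p\in[0,1]$ the likelihood $p\mapsto \Pr_p(K=k)$ of the observation.
   Context: PassUntil is the following evaluation procedure: for a task instance $s$, sample independent random generations from the model, checking each immediately after it is generated for whether it passes, and stop as soon as $r$ generations (with $r$ a fixed positive integer constant) have passed. $K$ denotes the total number of generations sampled, including the last, passing one. The PassUntil score is $\mathrm{PU}=r/K$. The number of failures $f=K-r$ follows the negative binomial distribution with $r$ required successes and success probability $P(s)=p$, so $\Pr_p(K=k)=\binom{k-1}{r-1}p^r(1-p)^{k-r}$ for integers $k\ge r$, with the convention $0^0=1$. *)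

(* Defs.v *)
From HB Require Import structures.
From mathcomp Require Import all_boot all_order all_algebra finmap.
From mathcomp Require Import all_classical all_reals all_analysis.

Set Implicit Arguments.
Unset Strict Implicit.
Unset Printing Implicit Defensive.

Import Order.TTheory GRing.Theory Num.Theory.

Local Open Scope classical_set_scope.
Local Open Scope ring_scope.

Definition mutually_independent (R : realType) (d d' : measure_display)
    (T : measurableType d) (T' : measurableType d') (P : probability T R)
    (X : nat -> {mfun T >-> T'}) : Prop :=
  forall (J : {fset nat}) (A : nat -> set T'),
    (forall i, i \in J -> measurable (A i)) ->
    P (\bigcap_(i in [set` J]) (X i @^-1` A i)) =
    (\prod_(i <- J) P (X i @^-1` A i))%E.

(* [X i w] says whether generation number i.+1 passes. *)
Definition independent_generations (R : realType) (d : measure_display)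
    (T : measurableType d) (P : probability T R)
    (X : nat -> {mfun T >-> bool}) (p : R) : Prop :=
  mutually_independent P X /\ forall i, P (X i @^-1` [set true]) = p%:E.

Definition num_passed (x : nat -> bool) (n : nat) : nat := (\sum_(i < n) x i)%N.

(* The total number K of generations sampled when stopping at the r-th pass;
   [None] when fewer than r generations ever pass, so that sampling never
   stops. *)
Definition num_generations (r : nat) (x : nat -> bool) : option nat :=
  if pselect (exists n, num_passed x n == r) is left h
  then Some (ex_minn h) else None.

Definition PU_score (R : realType) (r k : nat) : R := r%:R / k%:R.

Definition likelihood (R : realType) (d : measure_display)
    (T : measurableType d) (P : R -> probability T R)
    (X : nat -> {mfun T >-> bool}) (r k : nat) (p : R) : \bar R :=
  P p [set w | num_generations r (fun i => X i w) = Some k].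

Definition is_maximum_likelihood_estimate (R : realType) (Theta : set R)
    (L : R -> \bar R) (t : R) : Prop :=
  Theta t /\ forall u, Theta u -> (L u <= L t)%E.

(* Main.v *)
(* Whether sampling stops after exactly k generations depends only on the first
   k outcomes, and every outcome sequence for which it does contains exactly r
   passes, hence has probability p^r (1-p)^(k-r). The likelihood is therefore
   that monomial times a number N of sequences independent of p, so that the
   value of N is irrelevant; the monomial is maximal at r/k by the AM-GM
   inequality. *)
Require Import Defs.
From HB Require Import structures.
From mathcomp Require Import all_boot all_order all_algebra finmap.
From mathcomp Require Import all_classical all_reals all_analysis.

Import Order.TTheory GRing.Theory Num.Theory.

Local Open Scope classical_set_scope.
Local Open Scope ring_scope.

Lemma binomial_monomial_max (R : realFieldType) (r m : nat) (p : R) :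
  0 <= p <= 1 ->
  p ^+ r * (1 - p) ^+ m <=
    (r%:R / (r + m)%:R) ^+ r * (1 - r%:R / (r + m)%:R) ^+ m.
Proof.
move=> /andP[p0 p1].
have q0 : 0 <= 1 - p by rewrite subr_ge0.
have q1 : 1 - p <= 1 by rewrite gerBl.
(* The means below divide by [r] and [m], so zero exponents are treated apart: the right-hand side
   is then 1 and the left a power of [1 - p] or [p]. *)
have [->|r_gt0] := posnP r.
  by rewrite mul0r subr0 expr1n !mul1r exprn_ile1.
have [->|m_gt0] := posnP m.
  by rewrite addn0 divff ?pnatr_eq0 -?lt0n// expr1n !mulr1 exprn_ile1.
have rR : 0 < r%:R :> R by rewrite ltr0n.
have mR : 0 < m%:R :> R by rewrite ltr0n.
have nR : 0 < (r + m)%:R :> R by rewrite ltr0n addn_gt0 r_gt0.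
have -> : 1 - r%:R / (r + m)%:R = m%:R / (r + m)%:R :> R.
  by rewrite -{1}(divff (lt0r_neq0 nR)) -mulrBl natrD addrC addKr.
(* AM-GM for r copies of p / r and m copies of (1 - p) / m, which add up to 1. *)
pose E (i : 'I_r + 'I_m) : R := if i is inl _ then p / r%:R else (1 - p) / m%:R.
have E0 : {in predT, forall i, 0 <= E i}.
  by case=> i _ /=; rewrite divr_ge0// ltW.
have [+ _] := leif_AGM E0.
rewrite !big_sumType /= !sumr_const !prodr_const !cardT/= -!cardT.
rewrite card_sum !card_ord -(mulr_natr (p / _)) -(mulr_natr ((1 - p) / _)).
(* The mean is 1 / (r + m); clearing the denominator r^r m^m gives the claim. *)
rewrite !divfK ?lt0r_neq0// subrKC !expr_div_n expr1n !mulf_div -exprD.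
by rewrite ler_pdivrMr ?mulr_gt0 ?exprn_gt0// mul1r [X in _ <= X -> _]mulrC.
Qed.

Lemma num_passed_eq (x y : nat -> bool) (n : nat) :
  (forall i, (i < n)%N -> x i = y i) -> num_passed x n = num_passed y n.
Proof. by move=> xy; apply: eq_bigr => i _; rewrite xy. Qed.

Lemma num_generationsP (r : nat) (x : nat -> bool) (k : nat) :
  num_generations r x = Some k <->
  num_passed x k = r /\ forall n, num_passed x n = r -> (k <= n)%N.
Proof.
rewrite /num_generations; case: pselect => [h|nh]; last first.
  by split=> // -[xk _]; exfalso; apply: nh; exists k; apply/eqP.
case: ex_minnP => m /eqP xm m_min; split.
  by move=> [<-]; split=> // n /eqP/m_min.
move=> [/eqP xk k_min]; congr Some; apply/eqP.
by rewrite eqn_leq m_min//= k_min.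
Qed.

(** The stopping-time property: counts up to time [k] read only outcomes before [k], so [y] reaches
    [r] at [k] and no earlier. *)
Lemma num_generations_prefix (r : nat) (x y : nat -> bool) (k : nat) :
  (forall i, (i < k)%N -> x i = y i) ->
  num_generations r x = Some k -> num_generations r y = Some k.
Proof.
move=> xy /num_generationsP[xk k_min]; apply/num_generationsP; split.
  by rewrite -(@num_passed_eq x).
move=> n yn; rewrite leqNgt; apply/negP => n_lt_k.
suff /k_min : num_passed x n = r by rewrite leqNgt n_lt_k.
by rewrite -yn; apply: num_passed_eq => i i_lt_n; rewrite xy// (ltn_trans i_lt_n).
Qed.

Lemma prod_num_passed (R : comNzRingType) (p q : R) (x : nat -> bool) (n : nat) :
  \prod_(i < n) (if x i then p else q) =
  p ^+ num_passed x n * q ^+ (n - num_passed x n).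
Proof.
rewrite (bigID (fun i : 'I_n => x i)) /=.
rewrite (eq_bigr (fun=> p)) => [|i ->//].
rewrite [X in _ * X](eq_bigr (fun=> q)) => [|i /negbTE ->//].
rewrite !prodr_const.
have cardx : #|[pred i : 'I_n | x i]| = num_passed x n.
  rewrite /num_passed -sum1_card big_mkcond.
  by apply: eq_bigr => i _; rewrite inE; case: (x i).
rewrite cardx; congr (_ * _ ^+ _).
by rewrite -[X in (X - _)%N]card_ord -(cardC [pred i : 'I_n | x i]) cardx addKn.
Qed.

(** Indexed by a finite set so that [mutually_independent] applies directly. *)
Definition cylinder {d d' : measure_display} {T : measurableType d}
    {T' : measurableType d'} (X : nat -> {mfun T >-> T'}) (n : nat)
    (x : nat -> T') : set T :=
  \bigcap_(i in [set` [fset i in iota 0 n]%fset]) (X i @^-1` [set x i]).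

Section IndependentGenerations.
Variables (R : realType) (d : measure_display) (T : measurableType d).
Variable X : nat -> {mfun T >-> bool}.

Lemma in_cylinder (n : nat) (x : nat -> bool) (w : T) :
  cylinder X n x w <-> forall i, (i < n)%N -> X i w = x i.
Proof.
by split=> [+ i i_lt_n|+ i]; [move=> /(_ i)|]; rewrite /= ?inE ?mem_iota; [apply|auto].
Qed.

Lemma measurable_cylinder (n : nat) (x : nat -> bool) :
  measurable (cylinder X n x).
Proof.
apply: fin_bigcap_measurable => [|i _]; first exact: finite_fset.
exact: measurable_sfunP.
Qed.

Lemma prob_cylinder (P : probability T R) (p : R) (n : nat) (x : nat -> bool) :
  independent_generations P X p ->
  P (cylinder X n x) = (p ^+ num_passed x n * (1 - p) ^+ (n - num_passed x n))%:E.
Proof.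
move=> [indep passes]; rewrite indep//.
have PX i b : P (X i @^-1` [set b]) = (if b then p else 1 - p)%:E.
  case: b; first exact: passes.
  have -> : X i @^-1` [set false] = ~` (X i @^-1` [set true]).
    by apply/seteqP; split => w /=; case: (X i w).
  rewrite probability_setC ?passes//; exact: measurable_sfunP.
under eq_bigr do rewrite PX.
rewrite prodEFin -prod_num_passed -(big_mkord xpredT (fun i => if x i then p else 1 - p)).
(* The finite set and the list 0, ..., n-1 may enumerate the same indices in different orders. *)
congr _%:E; apply: perm_big; apply: uniq_perm => [||i].
- exact: fset_uniq.
- exact: iota_uniq.
- by rewrite !inE /index_iota subn0.
Qed.

(** [N] is chosen before [P] and [p], so that likelihoods at different parameters share the same
    factor. *)
Lemma prob_num_generations (r k : nat) :
  exists N : nat, forall (P : probability T R) (p : R),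
    independent_generations P X p ->
    P [set w | num_generations r (fun i => X i w) = Some k] =
    ((p ^+ r * (1 - p) ^+ (k - r)) *+ N)%:E.
Proof.
(* Padding a tuple with [false] is harmless, as only the first [k] outcomes matter. *)
pose D : set (k.-tuple bool) :=
  [set t | num_generations r (nth false t) = Some k].
exists #|` fset_set D| => P p indep.
have -> : [set w | num_generations r (fun i => X i w) = Some k] =
    \bigcup_(t in D) cylinder X k (nth false t).
  apply/seteqP; split=> w /=.
    move=> Kw; exists [tuple of mkseq (fun i => X i w) k].
      by apply: num_generations_prefix Kw => i i_lt_k; rewrite nth_mkseq.
    by apply/in_cylinder => i i_lt_k; rewrite nth_mkseq.
  move=> [t Dt /in_cylinder tw].
  by apply: num_generations_prefix Dt => i /tw.
rewrite measure_fin_bigcup; first last.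
- by move=> t _; exact: measurable_cylinder.
(* Disjointness: a common point [w] determines all [k] entries of both tuples. *)
- move=> s t _ _ [w [/in_cylinder sw /in_cylinder tw]].
  apply/val_inj/(@eq_from_nth _ false); rewrite !size_tuple// => i i_lt_k.
  by rewrite -sw// tw.
- exact: finite_finset.
rewrite fsbig_finite; last exact: finite_finset.
rewrite -sum1_size -sumrMnr -sumEFin.
apply: eq_big_seq => t; rewrite in_fset_set; last exact: finite_finset.
(* Each tuple in [D] has exactly [r] passes, so all summands are equal. *)
rewrite inE => /num_generationsP[tk _].
by rewrite -tk; exact: prob_cylinder.
Qed.

End IndependentGenerations.

Theorem theorem1 (R : realType) (d : measure_display) (T : measurableType d)
    (P : R -> probability T R) (X : nat -> {mfun T >-> bool}) (r : nat)
    (r_ge1 : (1 <= r)%N)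
    (PX : forall p : R, `[0, 1]%classic p -> independent_generations (P p) X p)
    (k : nat) (k_ge_r : (r <= k)%N) :
  is_maximum_likelihood_estimate `[0, 1]%classic (likelihood P X r k)
    (PU_score R r k).
Proof.
have k_gt0 : 0 < k%:R :> R by rewrite ltr0n (leq_trans r_ge1).
have PU01 : `[0, 1]%classic (PU_score R r k).
  by rewrite /= in_itv /= divr_ge0//= ler_pdivrMr// mul1r ler_nat.
split=> // p p01.
have [N probE] := prob_num_generations R d T X r k.
(* The common multiplicity [N] cancels, leaving the monomials in [p] and r/k to compare. *)
rewrite /likelihood !(probE _ _ (PX _ _))// lee_fin lerMn2r; apply/orP; right.
have := @binomial_monomial_max R r (k - r) p.
by rewrite subnKC//; apply; move: p01; rewrite /= in_itv.
Qed.
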